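(* There is a full-dimensional nine-point integral point set $X\subset\mathbb{R}^8$ of characteristic $1$ that admits no congruent realization in $\mathbb{Q}^8$; that is, no subset of $\mathbb{Q}^8$ is congruent to $X$.
   Context: An integral point set in $\mathbb{R}^d$ is a finite subset of $\mathbb{R}^d$ that affinely spans $\mathbb{R}^d$ and has all pairwise Euclidean distances integral. For a nondegenerate $d$-simplex with vertices $p_0,\ldots,p_d\in\mathbb{R}^d$ and rational edge lengths, its edge Gram matrix is $G=(\langle p_i-p_0,p_j-p_0\rangle)_{1\le i,j\le d}$, which has rational entries, and its characteristic is the class of $\det G$ in $\mathbb{Q}_{>0}^{\times}/\mathbb{Q}^{\times 2}$. The characteristic of a full-dimensional set with rational pairwise distances is the characteristic of any nondegenerate $d$-simplex with vertices in the set (it does not depend on the simplex). Characteristic $1$ means $\det G$ is a square in $\mathbb{Q}$. *)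

(* Defs.v *)
From mathcomp Require Export all_boot all_order all_algebra.
From mathcomp Require Export boolp classical_sets functions cardinality reals.

Set Implicit Arguments.
Unset Strict Implicit.
Unset Printing Implicit Defensive.

Import Order.TTheory GRing.Theory Num.Theory.

Local Open Scope classical_set_scope.
Local Open Scope ring_scope.

Section IntegralPointSets.
Variables (R : realType) (d : nat).
Implicit Types (X Y : set 'rV[R]_d) (u v x y : 'rV[R]_d).
Implicit Type p : 'I_d.+1 -> 'rV[R]_d.

Definition dotv u v : R := \sum_i u 0 i * v 0 i.

(* The library's norm on 'rV[R]_d is the sup norm, hence this definition. *)
Definition edist x y : R := Num.sqrt (dotv (x - y) (x - y)).

Definition affinely_spans X : Prop :=
  forall y, exists (n : nat) (x : 'I_n -> 'rV[R]_d) (c : 'I_n -> R),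
    [/\ forall i, X (x i), \sum_i c i = 1 & y = \sum_i c i *: x i].

Definition integral_point_set X : Prop :=
  [/\ finite_set X, affinely_spans X
    & forall x y, X x -> X y -> edist x y \is a Num.int].

Definition edge p (i : 'I_d) : 'rV[R]_d := p (lift ord0 i) - p ord0.

Definition nondegenerate p : Prop := row_free (\matrix_(i < d) edge p i).

Definition edge_gram p : 'M[R]_d :=
  \matrix_(i < d, j < d) dotv (edge p i) (edge p j).

(* det G is a rational in the class of q modulo nonzero rational squares. *)
Definition simplex_characteristic p (q : rat) : Prop :=
  exists2 r : rat, r != 0 & \det (edge_gram p) = ratr (q * r ^+ 2).

Definition simplex_in X p : Prop := nondegenerate p /\ forall i, X (p i).

(* The first conjunct prevents the second from holding vacuously. *)
Definition has_characteristic X (q : rat) : Prop :=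
  (exists p, simplex_in X p) /\
  (forall p, simplex_in X p -> simplex_characteristic p q).

Definition congruent X Y : Prop :=
  exists2 f : 'rV[R]_d -> 'rV[R]_d,
    forall x y, edist (f x) (f y) = edist x y & f @` X = Y.

Definition rational_points : set 'rV[R]_d :=
  [set x | forall i, rational (x 0 i)].

End IntegralPointSets.

Arguments rational_points : clear implicits.

(* Main.v *)
Require Import Defs.
From mathcomp Require Import ring lra zify.

Set Implicit Arguments.
Unset Strict Implicit.
Unset Printing Implicit Defensive.

Import Order.TTheory GRing.Theory Num.Theory.

Local Open Scope classical_set_scope.
Local Open Scope card_scope.
Local Open Scope ring_scope.

(** Over Q, write <a_1, ..., a_n> for the quadratic form sum a_i x_i^2. If the
    real coordinates of a finite set are rational multiples of fixed square
    roots sqrt a_1, ..., sqrt a_n, then its squared distances are values of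
    <a_1, ..., a_n> on rational vectors, and its characteristic is the class of
    a_1 ... a_n. A congruent copy in Q^n is the same thing as a rational
    isometry between <a_1, ..., a_n> and the sum of n squares. So the theorem
    asks for a form in eight variables with square determinant that is not
    equivalent to a sum of eight squares, yet carries a nine-point set with
    integral distances.

    The set consists of three equilateral triangles of side 6, centred at the
    vertices of a larger equilateral triangle, where the planes of the three
    triangles and the plane of their centres are mutually orthogonal. A centred
    triangle of side 6 has rational coordinates for <1, 3> and squared
    circumradius 12; if the centres are at squared distance 120, points of
    different triangles are at squared distance 12 + 12 + 120 = 12^2. A triangle
    of squared side 120 is rational for <10, 30>. The form is therefore
    <1, 3, 1, 3, 1, 3, 10, 30>, of determinant 90^2 ([site_sqdist],
    [prod_weights]).

    For the irrationality, the sum of eight squares is equivalent to four copies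
    of <1, 3> ([sum_of_squares_hex]), because three times a sum of four squares
    is a sum of four squares through a linear substitution. A rational copy
    would make three copies of <1, 3> plus <10, 30> equivalent to four copies
    of <1, 3>.
    Witt cancellation ([witt_cancellation]) would leave <10, 30> represented by
    <1, 3>, hence 10 = y^2 + 3 z^2 with y and z rational. This is impossible
    modulo 5, as -3 is not a square there ([ten_not_norm]). *)

(** * Diagonal quadratic forms and Witt cancellation *)

Section WeightedForms.
Variable F : fieldType.
Implicit Types (w : seq F) (n m : nat).

Definition wmx n w : 'M[F]_n := diag_mx (\row_(i < n) w`_i).

Definition wdot n w (x y : 'rV[F]_n) : F := \sum_(i < n) w`_i * (x 0 i * y 0 i).

Definition wnorm n w (x : 'rV[F]_n) : F := wdot w x x.

Lemma wdot_mx n w (x y : 'rV[F]_n) : wdot w x y = (x *m wmx n w *m y^T) 0 0.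
Proof.
rewrite /wdot mxE; apply: eq_bigr => i _.
by rewrite mul_mx_diag !mxE mulrA [w`_i * _]mulrC.
Qed.

Lemma gram_entry n m w (A : 'M[F]_(m, n)) i j :
  (A *m wmx n w *m A^T) i j = wdot w (row i A) (row j A).
Proof.
rewrite mxE /wdot; apply: eq_bigr => k _.
by rewrite mul_mx_diag !mxE mulrA [w`_k * _]mulrC.
Qed.

Lemma polarization n w (x y : 'rV[F]_n) :
  wdot w x y *+ 2 = wnorm w x + wnorm w y - wnorm w (x - y).
Proof.
rewrite /wnorm /wdot -big_split -sumrB -sumrMnl; apply: eq_bigr => i _ /=.
by rewrite !mxE; ring.
Qed.

(** Lengths and mutual distances of a family of vectors determine, by
    polarization, all inner products, hence the norm of every linear
    combination. Applied to the edges of a simplex, this turns a congruence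
    into an isometry of quadratic forms. *)
Lemma norm_of_equidistant n n' m w w' (A : 'M[F]_(m, n)) (B : 'M[F]_(m, n')) :
    (2%:R : F) != 0 ->
    (forall i, wnorm w (row i A) = wnorm w' (row i B)) ->
    (forall i j, wnorm w (row i A - row j A) = wnorm w' (row i B - row j B)) ->
  forall z, wnorm w (z *m A) = wnorm w' (z *m B).
Proof.
move=> two_neq0 eqn eqd z; rewrite /wnorm !wdot_mx !trmx_mul !mulmxA.
rewrite -[z *m A *m _]mulmxA -[z *m (_ *m _) *m _]mulmxA.
rewrite -[z *m B *m _]mulmxA -[z *m (B *m _) *m _]mulmxA.
suff -> : A *m wmx n w *m A^T = B *m wmx n' w' *m B^T by [].
apply/matrixP => i j; rewrite !gram_entry; apply: (mulIf two_neq0).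
by rewrite !mulr_natr !polarization !eqn eqd.
Qed.

Lemma wnorm_cons n a w (x : 'rV[F]_(1 + n)) :
  wnorm (a :: w) x = a * x 0 0 ^+ 2 + wnorm w (rsubmx x).
Proof.
rewrite /wnorm /wdot (@big_split_ord _ _ _ 1 n) /= big_ord1 /= -expr2.
congr (_ * x 0 _ ^+ 2 + _); first exact/val_inj.
by apply: eq_bigr => i _; rewrite !mxE.
Qed.

(** Witt's theorem in one step, by the substitution trick of Bruck and Ryser.
    In a x_0^2 + w(x) = a y_0^2 + w'(y), with y depending linearly on (x_0, x),
    choose x_0 as a linear function of x that makes y_0 = x_0 or y_0 = - x_0:
    the squares a x_0^2 and a y_0^2 then cancel. One of the two signs always
    gives a solvable equation, since the coefficient of x_0 in y_0 cannot be
    both 1 and -1. *)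
Lemma cancel_square n m a w w' (M : 'M[F]_(1 + n, 1 + m)) :
    (2%:R : F) != 0 ->
    (forall x : 'rV_(1 + n), wnorm (a :: w) x = wnorm (a :: w') (x *m M)) ->
  exists N : 'M_(n, m), forall x : 'rV_n, wnorm w x = wnorm w' (x *m N).
Proof.
move=> two_neq0 isoM.
set c := ulsubmx M 0 0.
(* e is the sign such that y_0 = e x_0 can be solved for x_0. *)
have [e e2 ec] : exists2 e : F, e ^+ 2 = 1 & e - c != 0.
  have [c1|] := eqVneq (1 - c) 0; last by exists 1 => //; rewrite expr1n.
  exists (- 1); first by rewrite sqrrN expr1n.
  apply: contraNneq two_neq0 => c2.
  by apply/eqP; rewrite -[RHS](subrr 0) -{1}c1 -c2; ring.
exists ((e - c)^-1 *: (dlsubmx M *m ursubmx M) + drsubmx M) => x.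
(* t is the chosen value of x_0, as a 1 x 1 block. *)
pose t := (e - c)^-1 *: (x *m dlsubmx M).
have tE : t 0 0 * (e - c) = (x *m dlsubmx M) 0 0.
  by rewrite /t mxE mulrAC mulVf // mul1r.
have := isoM (row_mx t x); rewrite !wnorm_cons -[M]submxK mul_row_block.
rewrite !row_mxKr !submxK.
have z0 : (0 : 'I_(1 + n)) = lshift n 0 by exact/val_inj.
have z0' : (0 : 'I_(1 + m)) = lshift m 0 by exact/val_inj.
rewrite z0 z0' !row_mxEl.
have -> : (t *m ulsubmx M + x *m dlsubmx M) 0 0 = e * t 0 0.
  rewrite mxE -tE [ulsubmx M]mx11_scalar mul_mx_scalar mxE -/c; ring.
rewrite exprMn e2 mul1r => /addrI ->; congr wnorm.
by rewrite mulmxDr /t -scalemxAl -scalemxAr mulmxA.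
Qed.

Theorem witt_cancellation n m u w w' (M : 'M[F]_(size u + n, size u + m)) :
    (2%:R : F) != 0 ->
    (forall x : 'rV_(size u + n),
       wnorm (u ++ w) x = wnorm (u ++ w') (x *m M)) ->
  exists N : 'M_(n, m), forall x : 'rV_n, wnorm w x = wnorm w' (x *m N).
Proof.
move=> two_neq0; elim: u M => [|a u IHu] M isoM; first by exists M.
have [N isoN] := @cancel_square (size u + n) (size u + m)
  a (u ++ w) (u ++ w') M two_neq0 isoM.
exact: IHu isoN.
Qed.

End WeightedForms.

(** * The form y^2 + 3 z^2 does not represent 10 over Q *)

(** Since -3 is not a square modulo 5, divisibility of a^2 + 3 b^2 by 5 forces 5
    to divide a and b, then 25 divides 10 c^2, so 5 divides c: descent. *)
Lemma ten_descent (a b c : nat) : (a ^ 2 + 3 * b ^ 2 = 10 * c ^ 2)%N -> c = 0%N.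
Proof.
elim/ltn_ind: c a b => c IHc a b abc.
have mod5 : (((a %% 5) ^ 2 + 3 * (b %% 5) ^ 2) %% 5 = 0)%N.
  transitivity ((10 * c ^ 2) %% 5)%N; last by lia.
  rewrite -abc -[in RHS]modnDm -[in RHS]modnMmr.
  by rewrite -(modnXm _ _ a) -(modnXm _ _ b) modnMmr modnDm.
have [a5 b5] : (a %% 5 = 0 /\ b %% 5 = 0)%N.
  move: mod5 (ltn_pmod a (isT : 0 < 5)%N) (ltn_pmod b (isT : 0 < 5)%N).
  by case: (a %% 5)%N => [|[|[|[|[|?]]]]]; case: (b %% 5)%N => [|[|[|[|[|?]]]]].
have [a' aE] : exists a', a = (5 * a')%N by exists (a %/ 5)%N; lia.
have [b' bE] : exists b', b = (5 * b')%N by exists (b %/ 5)%N; lia.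
have : (5 %| c ^ 2)%N by move: abc; rewrite aE bE !expnMn; lia.
rewrite Euclid_dvdX // andbT => /dvdnP[c' cE].
have [c0|c_gt0] := posnP c'; first by rewrite cE c0.
suff c'0 : c' = 0%N by rewrite c'0 in c_gt0.
by apply: (IHc c' _ a' b'); move: abc; rewrite ?aE ?bE cE ?expnMn; lia.
Qed.

Lemma ten_not_norm (y z : rat) : y ^+ 2 + 3%:R * z ^+ 2 != 10%:R.
Proof.
apply/eqP => yz.
pose c := denq y * denq z.
have cE : (numq y * denq z) ^+ 2 + 3 * (numq z * denq y) ^+ 2 = 10 * c ^+ 2.
  apply: (@intr_inj rat); rewrite /c !expr2 rmorphD !rmorphM /=.
  rewrite !numqE !rmorph_nat -yz; ring.
pose a := numq y * denq z; pose b := numq z * denq y.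
have abcN : (`|a| ^ 2 + 3 * `|b| ^ 2 = 10 * `|c| ^ 2)%N.
  by rewrite -/a -/b in cE; lia.
have /eqP := ten_descent abcN.
by rewrite absz_eq0 mulf_eq0 !(negPf (denq_neq0 _)).
Qed.

(** * Three triangles on a triangle *)

Definition weight : seq nat := [:: 1; 3; 1; 3; 1; 3; 10; 30]%N.

Definition weights : seq rat := [seq n%:R | n <- weight].

(** Points are numbered so that k / 3 is the triangle of the point k and k mod 3
    its position there; the coordinates 2 g and 2 g + 1 are those of the plane
    of the triangle g, and the last two those of the plane of the centres.
    Both tables list the vertices of a centred equilateral triangle, for
    <1, 3> and <10, 30> respectively. *)
Definition coord (k i : nat) : int :=
  if (i %/ 2 == k %/ 3)%N then
    nth 0 (nth [::] [:: [:: 3; -1]; [:: -3; -1]; [:: 0; 2]] (k %% 3)) (i %% 2)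
  else if (i %/ 2 == 3)%N then
    nth 0 (nth [::] [:: [:: 1; 1]; [:: 1; -1]; [:: -2; 0]] (k %/ 3)) (i %% 2)
  else 0.

Definition site (k : nat) : 'rV[rat]_8 := \row_i (coord k i)%:~R.

Definition site_dist (k l : nat) : nat :=
  if k == l then 0 else if (k %/ 3 == l %/ 3)%N then 6 else 12.

(** Iterated sums do not reduce, whereas folds of integers do: tables of
    rational sums with integer terms can thus be checked by evaluation. *)
Lemma eval_sums n m p (F : nat -> nat -> nat -> int) (G : nat -> nat -> int) :
    all (fun i => all (fun j =>
      foldr (fun k s => F i j k + s) 0 (iota 0 p) == G i j)
    (iota 0 m)) (iota 0 n) ->
  forall (i : 'I_n) (j : 'I_m), \sum_(k < p) (F i j k)%:~R = (G i j)%:~R :> rat.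
Proof.
move=> /allP FG i j.
have /FG/allP/(_ (nat_of_ord j)) : nat_of_ord i \in iota 0 n.
  by rewrite mem_iota /=.
rewrite mem_iota /= => /(_ (ltn_ord j)) /eqP <-.
by rewrite -rmorph_sum -(big_mkord xpredT (F i j)) unlock /index_iota subn0.
Qed.

Lemma site_sqdist (k l : 'I_9) :
  wnorm weights (site k - site l) = (site_dist k l)%:R ^+ 2.
Proof.
transitivity (((site_dist k l)%:Z ^+ 2)%:~R : rat); last by rewrite rmorphXn.
rewrite -(@eval_sums 9 9 8
  (fun k l i => (nth 0 weight i)%:Z * (coord k i - coord l i) ^+ 2)
  (fun k l => (site_dist k l)%:Z ^+ 2)); last by vm_compute.
apply: eq_bigr => i _.
by rewrite (nth_map 0%N) // !mxE rmorphM rmorphXn rmorphB expr2.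
Qed.

(** Coefficients of combinations of the sites, of total weight zero, that are
    multiples of the unit vectors: inside a triangle, a difference of two
    vertices and twice a vertex minus the other two; for the last two
    coordinates, up to sign and order, the same applied to the sums over the
    triangles, where the contributions of the triangles vanish because they are
    centred. *)
Definition comb (i k : nat) : int :=
  if (i < 6)%N then
    if (i %/ 2 == k %/ 3)%N then
      nth 0 (nth [::] [:: [:: 1; -1; 0]; [:: -1; -1; 2]] (i %% 2)) (k %% 3)
    else 0
  else nth 0 (nth [::] [:: [:: 1; 1; -2]; [:: 1; -1; 0]] (i %% 2)) (k %/ 3).

Definition edges_of n (q : 'I_n.+1 -> 'rV[rat]_n) : 'M[rat]_n :=
  \matrix_i (q (lift ord0 i) - q ord0).

Definition site_edges := edges_of (fun k : 'I_9 => site k).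

(** The nine sites are affinely independent: the combinations above express
    nonzero multiples of all unit vectors through the edges. *)
Lemma site_edges_unit : site_edges \in unitmx.
Proof.
(* The total weight being zero, the column of the base vertex can be dropped. *)
pose C : 'M[rat]_8 := \matrix_(i, k) (comb i k.+1)%:~R.
pose m i : nat := if (i == 6)%N then 18%N else 6%N.
have : C *m site_edges = diag_mx (\row_i (m i)%:R).
  apply/matrixP => i j.
  transitivity ((if (i == j :> nat) then (m i)%:Z else 0)%:~R : rat);
    last first.
    by rewrite !mxE -(inj_eq val_inj) /=; case: eqP.
  rewrite -(@eval_sums 8 8 8
    (fun i j k => comb i k.+1 * (coord k.+1 j - coord 0 j))
    (fun i j => if i == j then (m i)%:Z else 0)); last by vm_compute.
  by rewrite mxE; apply: eq_bigr => k _; rewrite !mxE rmorphM rmorphB.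
move=> CE; have : \det (C *m site_edges) != 0.
  rewrite CE det_diag; apply/prodf_neq0 => i _.
  by rewrite mxE pnatr_eq0 /m; case: ifP.
by rewrite det_mulmx mulf_eq0 unitmxE unitfE => /norP[].
Qed.

(** * The sum of eight squares as four copies of <1, 3> *)

(** Three times the change of variables. The odd columns carry the weighing
    matrix of order 4 and weight 3, whose rows and columns are orthogonal of
    squared length 3; the even columns copy the first four variables. *)
Definition hex_change (i j : nat) : int :=
  if odd j then
    nth 0 (nth [::] [:: [:: 0; 0; 0; 0; 1; 1; 1; 0];
                        [:: 0; 0; 0; 0; 1; -1; 0; 1];
                        [:: 0; 0; 0; 0; 1; 0; -1; -1];
                        [:: 0; 0; 0; 0; 0; 1; -1; 1]] (j %/ 2)) i
  else if (i == j %/ 2)%N then 3 else 0.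

Definition hex_weight : seq nat := [:: 1; 3; 1; 3; 1; 3; 1; 3]%N.

Lemma sum_of_squares_hex :
  exists K : 'M[rat]_8, forall y : 'rV_8,
    wnorm (nseq 8 1) y = wnorm [seq n%:R | n <- hex_weight] (y *m K).
Proof.
pose W : 'M[rat]_8 := \matrix_(i, j) (hex_change i j)%:~R.
exists (3%:R^-1 *: W) => y.
have WW : W *m wmx 8 [seq n%:R | n <- hex_weight] *m W^T = 9%:R%:M.
  apply/matrixP => i j; rewrite gram_entry.
  transitivity ((if (i == j :> nat) then 9 else 0 : int)%:~R : rat); last first.
    by rewrite !mxE -(inj_eq val_inj) /=; case: eqP.
  rewrite -(@eval_sums 8 8 8
    (fun i j k => (nth 0 hex_weight k)%:Z * (hex_change i k * hex_change j k))
    (fun i j => if i == j then 9 else 0)); last by vm_compute.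
  by apply: eq_bigr => k _; rewrite !mxE !rmorphM (nth_map 0%N).
rewrite /wnorm [RHS]wdot_mx -scalemxAr linearZ /= trmx_mul.
rewrite -!scalemxAl -scalemxAr.
rewrite !mulmxA -[y *m W *m _]mulmxA -[y *m _ *m W^T]mulmxA WW mul_mx_scalar.
rewrite -!scalemxAl !mxE /wdot.
have nine : 3%:R^-1 * (3%:R^-1 * 9%:R) = 1 :> rat by field.
rewrite mulrA mulrA nine mul1r.
by apply: eq_bigr => i _; rewrite mxE (nth_nseq 0 8 1 i) ltn_ord mul1r.
Qed.

(** * The sites have no rational copy *)

Theorem no_rational_copy (q : 'I_9 -> 'rV[rat]_8) :
  ~ (forall k l : 'I_9,
       wnorm (nseq 8 1) (q k - q l) = wnorm weights (site k - site l)).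
Proof.
move=> eqd.
pose B := edges_of q.
have isoB (x : 'rV_8) :
    wnorm weights x = wnorm (nseq 8 1) (x *m (invmx site_edges *m B)).
  rewrite -{1}(mulmxKV site_edges_unit x) mulmxA.
  apply: norm_of_equidistant => // [i|i j]; rewrite !rowK.
    by rewrite (eqd (lift ord0 i) ord0).
  have cancel_base (V : zmodType) (a b c : V) : a - c - (b - c) = a - b.
    by rewrite opprB addrA subrK.
  by rewrite !cancel_base (eqd (lift ord0 i) (lift ord0 j)).
(* Six of the eight terms agree on both sides and cancel. *)
have [K isoK] := sum_of_squares_hex.
pose u : seq rat := [:: 1; 3%:R; 1; 3%:R; 1; 3%:R].
have [|N isoN] := @witt_cancellation _ 2 2 u [:: 10%:R; 30%:R] [:: 1; 3%:R]
  (invmx site_edges *m B *m K) isT.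
  by move=> x; rewrite -[u ++ _]/weights isoB isoK !mulmxA.
(* The first unit vector has norm 10. *)
have := isoN (delta_mx 0 0); rewrite /wnorm /wdot !big_ord_recl !big_ord0 /=.
rewrite -rowE !mxE /= => E.
apply: (negP (ten_not_norm (N 0 0) (N 0 (lift ord0 ord0)))); apply/eqP.
by move: E; rewrite /= !mulr0 !addr0 !mulr1 mul1r !expr2.
Qed.

(** * Realization in Euclidean space *)

Section Realization.
Variable R : realType.

Lemma edist_sqr n (x y : 'rV[R]_n) : edist x y ^+ 2 = dotv (x - y) (x - y).
Proof.
by rewrite sqr_sqrtr // sumr_ge0 // => i _; rewrite -expr2 sqr_ge0.
Qed.

Lemma edge_gram_mul n (p : 'I_n.+1 -> 'rV[R]_n) :
  edge_gram p = (\matrix_i edge p i) *m (\matrix_i edge p i)^T.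
Proof.
apply/matrixP => i j; rewrite !mxE; apply: eq_bigr => k _.
by rewrite !mxE.
Qed.

Lemma nondegenerateE n (p : 'I_n.+1 -> 'rV[R]_n) :
  nondegenerate p <-> \det (edge_gram p) != 0.
Proof.
rewrite /nondegenerate edge_gram_mul det_mulmx det_tr mulf_eq0 orbb.
by rewrite row_free_unit unitmxE unitfE.
Qed.

Lemma simplex_spans n (X : set 'rV[R]_n) p : simplex_in X p -> affinely_spans X.
Proof.
move=> [nondeg Xp] y; exists n.+1, p.
pose E := \matrix_i edge p i; pose z := (y - p ord0) *m invmx E.
exists (fun k => if unlift ord0 k is Some i then z 0 i else 1 - \sum_i z 0 i).
split=> //.
  rewrite big_ord_recl unlift_none [X in _ + X](_ : _ = \sum_i z 0 i) ?subrK //.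
  by apply: eq_bigr => i _; rewrite liftK.
have zE : z *m E = y - p ord0 by rewrite mulmxKV // -row_free_unit.
rewrite -[LHS](subrK (p ord0)) -zE mulmx_sum_row big_ord_recl unlift_none.
rewrite scalerBl scale1r scaler_suml addrC -addrA; congr (_ + _).
rewrite addrC -sumrB; apply: eq_bigr => i _.
by rewrite liftK rowK /edge scalerBr.
Qed.

(** Scaling the axes by the square roots of the weights turns the form w
    into the Euclidean one. *)
Definition emb n (w : seq rat) (x : 'rV[rat]_n) : 'rV[R]_n :=
  \row_i (ratr (x 0 i) * Num.sqrt (ratr w`_i)).

Lemma embB n w (x y : 'rV[rat]_n) : emb w (x - y) = emb w x - emb w y.
Proof. by apply/rowP => i; rewrite !mxE rmorphB mulrBl. Qed.

Lemma dotv_emb n w (x y : 'rV[rat]_n) : all (>= 0) w ->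
  dotv (emb w x) (emb w y) = ratr (wdot w x y).
Proof.
move=> /(all_nthP 0) w_ge0; rewrite rmorph_sum; apply: eq_bigr => i _.
have wi_ge0 : 0 <= w`_i.
  by have [iw|iw] := ltnP i (size w); [exact: w_ge0 | rewrite nth_default].
rewrite !mxE mulrACA -expr2 sqr_sqrtr ?ler0q // !rmorphM /=; ring.
Qed.

Lemma edist_emb n w (x y : 'rV[rat]_n) : all (>= 0) w ->
  edist (emb w x) (emb w y) ^+ 2 = ratr (wnorm w (x - y)).
Proof. by move=> w_ge0; rewrite edist_sqr -embB dotv_emb. Qed.

Lemma det_edge_gram_emb n w (q : 'I_n.+1 -> 'rV[rat]_n) : all (>= 0) w ->
  \det (edge_gram (emb w \o q)) =
    ratr (\det (edges_of q) ^+ 2 * \prod_(i < n) w`_i).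
Proof.
move=> w_ge0.
have -> : edge_gram (emb w \o q)
    = map_mx ratr (edges_of q *m wmx n w *m (edges_of q)^T).
  apply/matrixP => i j; rewrite [RHS]mxE gram_entry !rowK mxE.
  by rewrite /edge /= -!embB dotv_emb.
rewrite det_map_mx !det_mulmx det_tr det_diag mulrAC expr2.
by congr (ratr (_ * _)); apply: eq_bigr => i _; rewrite mxE.
Qed.

(** The Gram determinant is the square of a rational determinant times the
    product of the weights, so its class is the same for all simplices. *)
Lemma simplex_characteristic_emb n w s (q : 'I_n.+1 -> 'rV[rat]_n) :
    all (>= 0) w -> \prod_(i < n) w`_i = s ^+ 2 ->
  nondegenerate (emb w \o q) -> simplex_characteristic (emb w \o q) 1.
Proof.
move=> w_ge0 ws2 /nondegenerateE; rewrite /simplex_characteristic.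
rewrite det_edge_gram_emb // ws2 -exprMn => det_neq0.
exists (\det (edges_of q) * s); last by rewrite mul1r.
by apply: contraNneq det_neq0 => ->; rewrite expr0n rmorph0.
Qed.

Definition site_set : set 'rV[R]_8 := [set emb weights (site k) | k in `I_9].

Lemma weights_ge0 : all (>= 0) weights.
Proof. by rewrite all_map; apply/allP => n _; exact: ler0n. Qed.

Lemma prod_weights : \prod_(i < 8) weights`_i = 90%:R ^+ 2.
Proof. by rewrite !big_ord_recl big_ord0 /=; ring. Qed.

Lemma edist_site (k l : 'I_9) :
  edist (emb weights (site k)) (emb weights (site l)) = (site_dist k l)%:R.
Proof.
apply/eqP; rewrite -(@eqrXn2 _ 2) ?sqrtr_ge0 ?ler0n //.
rewrite edist_emb ?weights_ge0 //.
by rewrite site_sqdist rmorphXn rmorph_nat.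
Qed.

Lemma site_simplex : nondegenerate (fun k : 'I_9 => emb weights (site k)).
Proof.
apply/nondegenerateE; rewrite (det_edge_gram_emb _ weights_ge0).
rewrite prod_weights fmorph_eq0.
apply: mulf_neq0; last by apply: expf_neq0; rewrite pnatr_eq0.
by apply: expf_neq0; have := site_edges_unit; rewrite unitmxE unitfE.
Qed.

Lemma site_simplex_in :
  simplex_in site_set (fun k : 'I_9 => emb weights (site k)).
Proof. by split=> [|k]; [exact: site_simplex | exists k => //=]. Qed.

Lemma site_setP x : site_set x -> exists k : 'I_9, x = emb weights (site k).
Proof. by case=> k /= k9 <-; exists (Ordinal k9). Qed.

Lemma site_set_integral : integral_point_set site_set.
Proof.
split; first exact/finite_image/finite_II.
  exact: simplex_spans site_simplex_in.
move=> x y /site_setP[k ->] /site_setP[l ->].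
by rewrite edist_site pmulrn intr_int.
Qed.

Lemma site_set_card : site_set #= `I_9.
Proof.
apply: inj_card_eq => k l; rewrite !inE /= => k9 l9 kl.
have := edist_site (Ordinal k9) (Ordinal l9).
rewrite /= kl (edist_site (Ordinal l9) (Ordinal l9)) /= /site_dist eqxx.
case: eqP => // _; case: ifP => _ /eqP.
  by rewrite eq_sym pnatr_eq0.
by rewrite eq_sym pnatr_eq0.
Qed.

Lemma site_set_characteristic : has_characteristic site_set 1.
Proof.
split; first by eexists; exact: site_simplex_in.
move=> p [nondeg /(fun h i => site_setP (h i))/choice[k pE]].
have pE' : p = emb weights \o (fun i => site (k i)) by apply/funext.
rewrite pE' in nondeg *.
exact: simplex_characteristic_emb weights_ge0 prod_weights nondeg.
Qed.

Lemma site_set_not_rational :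
  ~ exists2 Y : set 'rV[R]_8, Y `<=` rational_points R 8 & congruent site_set Y.
Proof.
move=> [Y Yrat [f f_iso fX]].
have /choice[q qE] (k : 'I_9) :
    exists q : 'rV[rat]_8, f (emb weights (site k)) = map_mx ratr q.
  have Yk : Y (f (emb weights (site k))).
    by rewrite -fX; exists (emb weights (site k)) => //; exists k => /=.
  have /choice[c cE] (i : 'I_8) :
      exists c : rat, ratr c = f (emb weights (site k)) 0 i.
    by have [c _ cE] := Yrat _ Yk i; exists c.
  by exists (\row_i c i); apply/rowP => i; rewrite !mxE cE.
apply: (no_rational_copy (q := q)) => k l.
apply: (fmorph_inj (ratr : rat -> R)).
transitivity (edist (emb weights (site k)) (emb weights (site l)) ^+ 2).
  2: exact: edist_emb weights_ge0.
rewrite -f_iso !qE edist_sqr -map_mxB /dotv /wnorm /wdot.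
rewrite rmorph_sum; apply: eq_bigr => i _.
by rewrite (nth_nseq 0 8 1 i) ltn_ord mul1r rmorphM !mxE.
Qed.

End Realization.

Theorem proposition6p2 (R : realType) :
  exists X : set 'rV[R]_8,
    [/\ X #= `I_9,
        integral_point_set X,
        has_characteristic X 1
      & ~ exists2 Y : set 'rV[R]_8, Y `<=` rational_points R 8 & congruent X Y].
Proof.
exists (@site_set R); split.
- exact: site_set_card.
- exact: site_set_integral.
- exact: site_set_characteristic.
- exact: site_set_not_rational.
Qed.
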